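(* Let $a<b$ be real and $\mathbf n\in\mathbb N^2$. Suppose $\Delta:\mathbf L^{\mathbf n}_{e,[a,b]}\to\mathbf L^{\mathbf n}_{e,[a,b]}$ is given by $(\Delta\mathbf v)(t)=\delta\,\mathbf v(t)$ for some $\delta\in\mathbb R$ with $|\delta|\le1$. Then for any PI operators $\mathcal P,\mathcal R$ on $\mathbf Z^{\mathbf n}$ with $\mathcal R^*=-\mathcal R$ and $\mathcal P^*=\mathcal P\ge0$, and any causal bounded linear operator $H:\mathbf L^{\mathbf n}_{e,[a,b]}\to\mathbf L^{\mathbf n}_{e,[a,b]}$, $\Delta$ satisfies the hard IQC defined by $$\mathcal K=\begin{bmatrix}\mathcal P&\mathcal R\\ \mathcal R^*&-\mathcal P\end{bmatrix}\quad\text{and}\quad\Psi=\begin{bmatrix}H&0\\0&H\end{bmatrix}.$$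
   Context: Signal spaces. For $\mathbf n=(n_1,n_2)\in\mathbb N^2$, $\mathbf Z^{\mathbf n}:=\mathbb R^{n_1}\times L_2^{n_2}[a,b]$ is the real Hilbert space with inner product $\langle(u,U),(v,V)\rangle_{\mathbf Z}=u^Tv+\int_a^bU(s)^TV(s)\,ds$. $\mathbf L^{\mathbf n}_{e,[a,b]}$ is the space of (strongly measurable) functions $\mathbf u:[0,\infty)\to\mathbf Z^{\mathbf n}$ with $\int_0^T\|\mathbf u(t)\|_{\mathbf Z}^2dt<\infty$ for all $T\ge0$; $\langle\mathbf u,\mathbf v\rangle_{\mathbf L}=\int_0^\infty\langle\mathbf u(t),\mathbf v(t)\rangle_{\mathbf Z}dt$ for square-integrable $\mathbf u,\mathbf v$. Stacking $\begin{bmatrix}\mathbf u\\ \mathbf v\end{bmatrix}$ is component-wise concatenation, identifying $\mathbf Z^{\mathbf n}\times\mathbf Z^{\mathbf n}$ with $\mathbf Z^{2\mathbf n}$; block operators are understood via this identification. $(P_\tau\mathbf y)(t)=\mathbf y(t)$ for $0\le t\le\tau$ and $0$ otherwise; $(M_{\mathcal K}\mathbf w)(t):=\mathcal K\mathbf w(t)$. An operator $F$ on extended spaces is causal if $P_\tau F=P_\tau FP_\tau$ for all $\tau\ge0$, and bounded if there is $C\ge0$ with $\|P_\tau F\mathbf v\|_{\mathbf L}\le C\|P_\tau\mathbf v\|_{\mathbf L}$ for all $\mathbf v$, $\tau\ge0$. Hard IQC. $\Delta:\mathbf L^{\mathbf n}_{e,[a,b]}\to\mathbf L^{\mathbf n}_{e,[a,b]}$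 satisfies the hard IQC defined by $\Psi:\mathbf L^{2\mathbf n}_{e,[a,b]}\to\mathbf L^{2\mathbf n}_{e,[a,b]}$ and bounded linear $\mathcal K:\mathbf Z^{2\mathbf n}\to\mathbf Z^{2\mathbf n}$ if for all $T>0$ and all $\mathbf v\in\mathbf L^{\mathbf n}_{e,[a,b]}$, $\left\langle P_T\Psi\begin{bmatrix}\mathbf v\\ \Delta\mathbf v\end{bmatrix},P_TM_{\mathcal K}\Psi\begin{bmatrix}\mathbf v\\ \Delta\mathbf v\end{bmatrix}\right\rangle_{\mathbf L}\ge0$. PI operators. A Partial Integral (PI) operator on $\mathbf Z^{\mathbf n}$ is a map of the form $$\begin{bmatrix}x\\ \mathbf x\end{bmatrix}\mapsto\begin{bmatrix}Px+\int_a^bQ_1(s)\mathbf x(s)\,ds\\ Q_2(s)x+R_0(s)\mathbf x(s)+\int_a^sR_1(s,\theta)\mathbf x(\theta)\,d\theta+\int_s^bR_2(s,\theta)\mathbf x(\theta)\,d\theta\end{bmatrix}$$ with $P$ a matrix, $Q_1,Q_2,R_0$ bounded (measurable) matrix-valued functions and $R_1,R_2$ separable (finite sums of products of a bounded function of $s$ and a bounded function of $\theta$). PI operators are bounded linear operators; $^*$ is the Hilbert space adjoint, and $\mathcal P\ge0$ means $\langle z,\mathcal Pz\rangle\ge0$ for all $z$. *)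

(* Defs.v *)
From HB Require Import structures.
From mathcomp Require Import all_boot all_order all_algebra.
From mathcomp Require Import all_classical all_reals all_analysis.
From mathcomp Require Import measurable_realfun ess_sup_inf.

Set Implicit Arguments.
Unset Strict Implicit.
Unset Printing Implicit Defensive.

Import Order.TTheory GRing.Theory Num.Theory.
Import numFieldNormedType.Exports.

Local Open Scope classical_set_scope.
Local Open Scope ring_scope.

(* The library's Lp spaces consist of classes of functions modulo equality
   almost everywhere, but have no vector space structure; it is built here
   from the operations on representatives. *)
Section Lspace_lmodule.
Context d (T : measurableType d) (R : realType).
Variables (mu : {measure set T -> \bar R}) (p : \bar R) (p1 : (1 <= p)%E).
Local Notation Lp := (LspaceType mu p1).
Local Notation Lf := (LfunType mu p1).
Local Notation aeMfun := ({mfun_ mu, T >-> measurableTypeR R}).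
Local Open Scope quotient_scope.

HB.instance Definition _ := gen_eqMixin Lp.
HB.instance Definition _ := gen_choiceMixin Lp.

Lemma repr_pi_ae (f : {mfun T >-> measurableTypeR R}) :
  repr (\pi_aeMfun f) = (f : T -> R) %[ae mu].
Proof.
have /eqP := reprK (\pi_aeMfun f).
by rewrite eqmodE => /asboolP.
Qed.

Lemma finite_norm_ae (f g : {mfun T >-> measurableTypeR R}) :
  f = (g : T -> R) %[ae mu] -> finite_norm mu p g -> finite_norm mu p f.
Proof.
move=> fg.
have /measurable_EFinP mf : measurable_fun [set: T] f by [].
have /measurable_EFinP mg : measurable_fun [set: T] g by [].
rewrite /finite_norm !unlock; case: (p) p1 => [r r1||//].
  suff -> : (\int[mu]_x (`|(EFin \o f) x| `^ r) =
             \int[mu]_x (`|(EFin \o g) x| `^ r))%E by [].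
  apply: (@ae_eq_integral _ _ _ mu) => //.
  - apply: (measurableT_comp (measurable_poweR _)); exact: (measurableT_comp _ mf).
  - apply: (measurableT_comp (measurable_poweR _)); exact: (measurableT_comp _ mg).
  - by apply: filterS fg => x /= /(_ I) ->.
move=> _; rewrite (@eq_ess_sup _ _ _ _ (abse \o (EFin \o (f : T -> R))) (abse \o (EFin \o g)))//.
by apply: filterS fg => x /= /(_ I) ->.
Qed.

Lemma mfun_subproof (f : {mfun T >-> R}) :
  measurable_fun [set: T] (f : T -> measurableTypeR R).
Proof. exact: (@measurable_funPT _ _ _ _ f). Qed.

Definition mfun_R (f : {mfun T >-> R}) : {mfun T >-> measurableTypeR R} :=
  HB.pack (f : T -> measurableTypeR R)
    (@isMeasurableFun.Build _ _ T (measurableTypeR R) f (@mfun_subproof f)).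

Lemma Lspace_of_subproof (f : Lf) : 
  finite_norm mu p (\pi_aeMfun (mfun_R f) : aeMfun).
Proof. by apply: (finite_norm_ae (repr_pi_ae _)); exact: Lfunction_finite. Qed.

Definition Lspace_of (f : Lf) : Lp :=
  HB.pack (\pi_aeMfun (mfun_R f))
    (@isFinLebesgue.Build d T R mu p p1 _ (Lspace_of_subproof f)).

Lemma Lfun_of_subproof (x : Lp) : (x : T -> R) \in Lfun mu p.
Proof.
rewrite inE; apply/andP; split; rewrite inE /=.
  exact: (@measurable_funPT _ _ _ _ (repr (LebesgueSpace.sort x))).
exact: Lebesgue_finite.
Qed.

Definition Lfun_of (x : Lp) : Lf := Lfun_Sub p1 (Lfun_of_subproof x).

Lemma Lspace_ofE (f : Lf) : (Lspace_of f : T -> R) = f %[ae mu].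
Proof. exact: repr_pi_ae. Qed.

Lemma Lfun_ofE (x : Lp) : Lfun_of x = x :> (T -> R).
Proof. by []. Qed.

Lemma Lspace_eqP (x y : Lp) : (x : T -> R) = y %[ae mu] -> x = y.
Proof.

move=> xy; have : LebesgueSpace.sort x = LebesgueSpace.sort y.
  rewrite -[LHS]reprK -[RHS]reprK; apply/eqP; rewrite eqmodE; exact/asboolP.
case: x y {xy} => [x [[xP]]] [y [[yP]]] /= xy.
by rewrite xy in xP *; rewrite (Prop_irrelevance xP yP).
Qed.

Definition Lspace_add (x y : Lp) : Lp := Lspace_of (Lfun_of x + Lfun_of y).
Definition Lspace_scale (c : R) (x : Lp) : Lp := Lspace_of (c *: Lfun_of x).

Definition Lspace_opp (x : Lp) : Lp := Lspace_of (- Lfun_of x).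

Lemma Lspace_addE (x y : Lp) :
  \forall t \ae mu, (Lspace_add x y : T -> R) t = (x : T -> R) t + (y : T -> R) t.
Proof. by apply: filterS (Lspace_ofE (Lfun_of x + Lfun_of y)) => t /(_ Logic.I). Qed.

Lemma Lspace_scaleE (c : R) (x : Lp) :
  \forall t \ae mu, (Lspace_scale c x : T -> R) t = c * (x : T -> R) t.
Proof. by apply: filterS (Lspace_ofE (c *: Lfun_of x)) => t /(_ Logic.I). Qed.

Lemma Lspace_oppE (x : Lp) :
  \forall t \ae mu, (Lspace_opp x : T -> R) t = - (x : T -> R) t.
Proof. by apply: filterS (Lspace_ofE (- Lfun_of x)) => t /(_ Logic.I). Qed.

Lemma Lspace_zeroE : \forall t \ae mu, (Lspace_of 0 : T -> R) t = 0.
Proof. by apply: filterS (Lspace_ofE 0) => t /(_ Logic.I). Qed.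

Let addA : associative Lspace_add.
Proof.
move=> x y z; apply: Lspace_eqP.
apply: filterS (filterI (Lspace_addE x (Lspace_add y z)) (filterI (Lspace_addE y z)
  (filterI (Lspace_addE (Lspace_add x y) z) (Lspace_addE x y)))).
by move=> t [-> [-> [-> ->]]] _; rewrite addrA.
Qed.

Let addC : commutative Lspace_add.
Proof.
move=> x y; apply: Lspace_eqP.
apply: filterS (filterI (Lspace_addE x y) (Lspace_addE y x)).
by move=> t [-> ->] _; rewrite addrC.
Qed.

Let add0 : left_id (Lspace_of 0) Lspace_add.
Proof.
move=> x; apply: Lspace_eqP.
apply: filterS (filterI (Lspace_addE (Lspace_of 0) x) Lspace_zeroE).
by move=> t [-> ->] _; rewrite add0r.
Qed.

Let addN : left_inverse (Lspace_of 0) Lspace_opp Lspace_add.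
Proof.
move=> x; apply: Lspace_eqP.
apply: filterS (filterI (Lspace_addE (Lspace_opp x) x)
  (filterI (Lspace_oppE x) Lspace_zeroE)).
by move=> t [-> [-> ->]] _; rewrite addNr.
Qed.

HB.instance Definition _ := GRing.isZmodule.Build Lp addA addC add0 addN.

Let scaleA a b (x : Lp) :
  Lspace_scale a (Lspace_scale b x) = Lspace_scale (a * b) x.
Proof.
apply: Lspace_eqP.
apply: filterS (filterI (Lspace_scaleE a (Lspace_scale b x))
  (filterI (Lspace_scaleE b x) (Lspace_scaleE (a * b) x))).
by move=> t [-> [-> ->]] _; rewrite mulrA.
Qed.

Let scale1 : left_id 1 Lspace_scale.
Proof.
move=> x; apply: Lspace_eqP; apply: filterS (Lspace_scaleE 1 x).
by move=> t -> _; rewrite mul1r.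
Qed.

Let scaleDr : right_distributive Lspace_scale +%R.
Proof.
move=> a x y; apply: Lspace_eqP.
apply: filterS (filterI (Lspace_scaleE a (x + y)) (filterI (Lspace_addE x y)
  (filterI (Lspace_addE (Lspace_scale a x) (Lspace_scale a y))
  (filterI (Lspace_scaleE a x) (Lspace_scaleE a y))))).
by move=> t [-> [-> [-> [-> ->]]]] _; rewrite mulrDr.
Qed.

Let scaleDl (x : Lp) : {morph Lspace_scale^~ x : a b / a + b}.
Proof.
move=> a b; apply: Lspace_eqP.
apply: filterS (filterI (Lspace_scaleE (a + b) x)
  (filterI (Lspace_addE (Lspace_scale a x) (Lspace_scale b x))
  (filterI (Lspace_scaleE a x) (Lspace_scaleE b x)))).
by move=> t [-> [-> [-> ->]]] _; rewrite mulrDl.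
Qed.

HB.instance Definition _ :=
  GRing.Zmodule_isLmodule.Build R Lp scaleA scale1 scaleDr scaleDl.

End Lspace_lmodule.

Section Signals.
Context (R : realType) (a b : R).

Definition lebesgue_on : {measure set (measurableTypeR R) -> \bar R} :=
  mrestr (@lebesgue_measure R) (measurable_itv `[a, b]).

Definition L2 : Type := LspaceType2 lebesgue_on.

Definition Z (n : nat * nat) : Type :=
  ('cV[R]_n.1 * {ffun 'I_n.2 -> L2})%type.

Section Space.
Context (n : nat * nat).

Definition Zfun (z : Z n) (s : R) : 'cV[R]_n.2 := \col_i z.2 i s.

Definition dotZ (u v : Z n) : R :=
  (u.1^T *m v.1) ord0 ord0 +
  \int[lebesgue_on]_s ((Zfun u s)^T *m Zfun v s) ord0 ord0.

Definition normZ (z : Z n) : R := Num.sqrt (dotZ z z).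

Definition is_adjoint (A B : Z n -> Z n) :=
  forall u v, dotZ (A u) v = dotZ u (B v).

(* The Hilbert space adjoint is unique when it exists, and it exists for every
   bounded linear operator; 0 is only a default value. *)
Definition adjoint (A : Z n -> Z n) : Z n -> Z n :=
  xget 0 [set B | is_adjoint A B].

Definition nonnegZ (A : Z n -> Z n) := forall z, 0 <= dotZ z (A z).

End Space.

Definition bounded_meas m k (F : R -> 'M[R]_(m, k)) :=
  forall i j,
    measurable_fun (`[a, b] : set (measurableTypeR R)) (fun s => F s i j) /\
    exists C : R, forall s, s \in `[a, b] -> `|F s i j| <= C.

Definition separable_kernel m (K : R -> R -> 'M[R]_m) :=
  exists (N : nat) (F G : 'I_N -> R -> 'M[R]_m),
    (forall k, bounded_meas (F k) /\ bounded_meas (G k)) /\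
    (forall s th, s \in `[a, b] -> th \in `[a, b] ->
      K s th = \sum_k F k s *m G k th).

Definition int_col m (D : set R) (f : R -> 'cV[R]_m) : 'cV[R]_m :=
  \col_i \int[lebesgue_on]_(s in D) f s i ord0.

(* The complement of [a, b] is negligible for lebesgue_on, so the second
   component is prescribed at almost every s in [a, b]. *)
Definition is_PI n (A : Z n -> Z n) :=
  exists (P : 'M[R]_n.1) (Q1 : R -> 'M[R]_(n.1, n.2))
    (Q2 : R -> 'M[R]_(n.2, n.1)) (R0 : R -> 'M[R]_n.2)
    (R1 R2 : R -> R -> 'M[R]_n.2),
    [/\ bounded_meas Q1 /\ bounded_meas Q2, bounded_meas R0,
        separable_kernel R1, separable_kernel R2 &
        forall z : Z n,
          (A z).1 = P *m z.1 + int_col `[a, b] (fun s => Q1 s *m Zfun z s) /\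
          {ae lebesgue_on, forall s,
             Zfun (A z) s = Q2 s *m z.1 + R0 s *m Zfun z s
               + int_col `[a, s] (fun th => R1 s th *m Zfun z th)
               + int_col `[s, b] (fun th => R2 s th *m Zfun z th)}].

Definition dbl (n : nat * nat) : nat * nat := (n.1 + n.1, n.2 + n.2)%N.

Definition stackZ n (u v : Z n) : Z (dbl n) :=
  (col_mx u.1 v.1,
   [ffun i : 'I_(n.2 + n.2) =>
      match fintype.split i with inl j => u.2 j | inr j => v.2 j end]).

Definition topZ n (w : Z (dbl n)) : Z n :=
  (usubmx w.1, [ffun i : 'I_n.2 => w.2 (lshift n.2 i)]).

Definition botZ n (w : Z (dbl n)) : Z n :=
  (dsubmx w.1, [ffun i : 'I_n.2 => w.2 (rshift n.2 i)]).

Definition blockZ n (A B C D : Z n -> Z n) (w : Z (dbl n)) : Z (dbl n) :=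
  stackZ (A (topZ w) + B (botZ w)) (C (topZ w) + D (botZ w)).

(* A signal is given by a function on R of which only the restriction to
   [0, +oo[ matters, and signals are identified when they agree at almost
   every nonnegative time. *)
Definition eqL n (u v : R -> Z n) :=
  {ae @lebesgue_measure R, forall t, 0 <= t -> u t = v t}.

Definition simpleZ n (s : R -> Z n) :=
  finite_set (range s) /\
  forall z, measurable (s @^-1` [set z] : set (measurableTypeR R)).

Definition strongly_measurable n (u : R -> Z n) :=
  exists s : nat -> R -> Z n, (forall k, simpleZ (s k)) /\
    {ae @lebesgue_measure R, forall t, 0 <= t ->
       (fun k => normZ (u t - s k t)) @ \oo --> (0 : R)}.

Definition Le n : set (R -> Z n) :=
  [set u | strongly_measurable u /\ forall T : R, 0 <= T ->
    (\int[@lebesgue_measure R]_(t in `[0%R, T]) (normZ (u t) ^+ 2)%:E < +oo)%E].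

Definition dotL n (u v : R -> Z n) : R :=
  \int[@lebesgue_measure R]_(t in `[0, +oo[) dotZ (u t) (v t).

Definition normL n (u : R -> Z n) : R := Num.sqrt (dotL u u).

Definition trunc n (tau : R) (y : R -> Z n) : R -> Z n :=
  fun t => if 0 <= t <= tau then y t else 0.

Definition multL n (K : Z n -> Z n) (w : R -> Z n) : R -> Z n :=
  fun t => K (w t).

Definition stackL n (u v : R -> Z n) : R -> Z (dbl n) :=
  fun t => stackZ (u t) (v t).

Definition blockL n (A B C D : (R -> Z n) -> (R -> Z n)) (w : R -> Z (dbl n)) :
    R -> Z (dbl n) :=
  let u := fun t => topZ (w t) in
  let v := fun t => botZ (w t) in
  stackL (A u + B v) (C u + D v).

Section Operators.
Context (n : nat * nat) (F : (R -> Z n) -> (R -> Z n)).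

(* F maps L_e to L_e and is well defined on classes of signals. *)
Definition operatorL :=
  (forall v, Le v -> Le (F v)) /\
  (forall u v, Le u -> Le v -> eqL u v -> eqL (F u) (F v)).

Definition linearL := forall (c : R) u v, Le u -> Le v ->
  eqL (F (c *: u + v)) (c *: F u + F v).

Definition causalL := forall tau v, 0 <= tau -> Le v ->
  eqL (trunc tau (F v)) (trunc tau (F (trunc tau v))).

Definition boundedL := exists2 C : R, 0 <= C & forall v tau, Le v -> 0 <= tau ->
  normL (trunc tau (F v)) <= C * normL (trunc tau v).

End Operators.

Definition hard_IQC n (Delta : (R -> Z n) -> (R -> Z n))
    (Psi : (R -> Z (dbl n)) -> (R -> Z (dbl n))) (K : Z (dbl n) -> Z (dbl n)) :=
  forall (T : R) (v : R -> Z n), 0 < T -> Le v ->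
    let w := Psi (stackL v (Delta v)) in
    0 <= dotL (trunc T w) (trunc T (multL K w)).

End Signals.

(* Main.v *)
(* Skew-adjointness gives <h, S h> = 0, so that with h = H v and H (Delta v) =
   delta H v the integrand of the IQC is (1 - delta^2) <h, P h> >= 0 almost
   everywhere. The algebra only uses the adjunction identities: an operator
   whose [adjoint] is the default value 0 must itself vanish here, and then the
   identities hold trivially. *)
Require Import Defs.
From mathcomp Require Import all_boot all_order all_algebra.
From mathcomp Require Import all_classical all_reals all_analysis.
From mathcomp Require Import ring.

Import Order.TTheory GRing.Theory Num.Theory.

Local Open Scope ring_scope.

(** * Sign and monotonicity of integrals *)

Section IntegralWithoutMeasurability.
Local Open Scope classical_set_scope.
Local Open Scope ereal_scope.
Context {d} {T : measurableType d} {R : realType} {mu : {measure set T -> \bar R}}.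

Lemma ae_imp {P Q : T -> Prop} : (forall x, P x -> Q x) ->
  {ae mu, forall x, P x} -> {ae mu, forall x, Q x}.
Proof. by move=> PQ; apply: filterS. Qed.

Lemma ae_imp2 {P Q S : T -> Prop} : (forall x, P x -> Q x -> S x) ->
  {ae mu, forall x, P x} -> {ae mu, forall x, Q x} -> {ae mu, forall x, S x}.
Proof. by move=> PQS; apply: filterS2. Qed.

(** The integral of a nonnegative function is a supremum over the simple functions below it, and
    every simple function below [f] on [D] is also below [g]. *)
Lemma ge0_le_integral_nonmeas (D : set T) (f g : T -> \bar R) :
  (forall x, D x -> 0 <= f x) -> (forall x, D x -> f x <= g x) ->
  \int[mu]_(x in D) f x <= \int[mu]_(x in D) g x.
Proof.
move=> f0 fg.
rewrite !ge0_integralE//; last by move=> x Dx; exact: le_trans (f0 _ Dx) (fg _ Dx).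
apply: ge_ereal_sup => _ [h /= hf <-]; apply: ereal_sup_ubound; exists h => //= x.
apply: le_trans (hf x) _; rewrite /patch; case: ifPn => // xD.
by apply: fg; exact: set_mem.
Qed.

(** The negative part is dominated by the function equal to [+oo] on a null set and 0 elsewhere, so
    its integral vanishes. Only the integral of the positive part remains, and if that is [+oo],
    [fine] turns it into 0, which is still nonnegative. *)
Lemma Rintegral_ae_ge0 (D : set T) (f : T -> R) :
  {ae mu, forall x, D x -> (0 <= f x)%R} -> (0 <= Rintegral mu D f)%R.
Proof.
move=> [N [mN N0 fN]]; apply: fine_ge0; rewrite integralE.
suff -> : \int[mu]_(x in D) (fun x => (f x)%:E)^\- x = 0.
  by rewrite sube0; apply: integral_ge0.
apply/eqP; rewrite eq_le integral_ge0// andbT.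
have <- : \int[mu]_(x in N) (cst +oo : T -> \bar R) x = 0.
  by rewrite null_set_integral//.
rewrite integral_mkcond [leRHS]integral_mkcond; apply: ge0_le_integral_nonmeas => x _.
  by apply: erestrict_ge0.
rewrite /patch; case: ifPn => [/set_mem Dx|_]; last by case: ifP; rewrite ?leey.
case: ifPn => [_|/negP Nx]; first by rewrite leey.
have /contrapT /(_ Dx) f0 : ~ ~ (D x -> (0 <= f x)%R).
  by move=> /fN /mem_set.
by rewrite funenegE -EFinN ge_max lee_fin oppr_le0 f0 lexx.
Qed.

End IntegralWithoutMeasurability.

(** * Bilinearity of the inner product, and stacking *)

Section InnerProduct.
Local Open Scope classical_set_scope.
Context {R : realType} {a b : R}.
Local Notation mu := (lebesgue_on a b).
Local Notation L2 := (L2 a b).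

Definition dotL2 (x y : L2) : R := \int[mu]_s ((x : _ -> R) s * (y : _ -> R) s).

Lemma integrable_mulL2 (x y : L2) :
  mu.-integrable setT (EFin \o (fun s => (x : _ -> R) s * (y : _ -> R) s)).
Proof. by apply/Lfun1_integrable/Lfun2_mul_Lfun1; exact: Lfun_of_subproof. Qed.

Lemma dotL2C x y : dotL2 x y = dotL2 y x.
Proof. by apply: eq_Rintegral => s _; rewrite mulrC. Qed.

(** The representative of a sum or a multiple in [L2] is known only almost everywhere; this lets the
    pointwise formula [f] replace it under the integral. *)
Lemma dotL2_ae (x y : L2) (f : R -> R) : 
  mu.-integrable setT (EFin \o f) ->
  {ae mu, forall s, f s = (x : _ -> R) s * (y : _ -> R) s} ->
  dotL2 x y = \int[mu]_s f s.
Proof.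
move=> intf fxy; congr fine; apply: ae_eq_integral => //.
- exact: measurable_int (integrable_mulL2 x y).
- exact: measurable_int intf.
- by apply: ae_imp fxy => s /= ->.
Qed.

Lemma dotL2Dl x y z : dotL2 (x + y) z = dotL2 x z + dotL2 y z.
Proof.
rewrite -RintegralD ?integrable_mulL2//; apply: dotL2_ae.
  by have := integrableD _ (integrable_mulL2 x z) (integrable_mulL2 y z); apply.
by apply: ae_imp (Lspace_addE x y) => s ->; rewrite mulrDl.
Qed.

Lemma dotL2Zl c x y : dotL2 (c *: x) y = c * dotL2 x y.
Proof.
rewrite -RintegralZl ?integrable_mulL2//; apply: dotL2_ae.
  by have := integrableZl _ c (integrable_mulL2 x y); apply.
by apply: ae_imp (Lspace_scaleE c x) => s ->; rewrite mulrA.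
Qed.

Context {n : nat * nat}.
Implicit Types u v w : Z a b n.

(** Products of two square-integrable functions are integrable, so the integral passes through the
    finite sum. Bilinearity can then be checked component by component. *)
Lemma dotZE m (u v : Z a b m) : dotZ u v =
  \sum_j u.1 j ord0 * v.1 j ord0 + \sum_i dotL2 (u.2 i) (v.2 i).
Proof.
rewrite /dotZ mxE; congr (_ + _); first by apply: eq_bigr => j _; rewrite mxE.
rewrite /Rintegral.
under eq_integral => s _.
  rewrite mxE; under eq_bigr => j _ do rewrite !mxE; rewrite -sumEFin; over.
rewrite integral_sum//; last by move=> i; exact: integrable_mulL2.
rewrite (eq_bigr (fun i => (dotL2 (u.2 i) (v.2 i))%:E)) ?sumEFin// => i _.
by rewrite fineK//; apply: integrable_fin_num => //; exact: integrable_mulL2.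
Qed.

Lemma dotZC u v : dotZ u v = dotZ v u.
Proof.
rewrite !dotZE; congr (_ + _); apply: eq_bigr => i _; first by rewrite mulrC.
exact: dotL2C.
Qed.

Lemma dotZDl u v w : dotZ (u + v) w = dotZ u w + dotZ v w.
Proof.
rewrite !dotZE addrACA -!big_split/=; congr (_ + _); apply: eq_bigr => i _.
  by rewrite mxE mulrDl.
by rewrite ffunE dotL2Dl.
Qed.

Lemma dotZZl c u v : dotZ (c *: u) v = c * dotZ u v.
Proof.
rewrite !dotZE mulrDr !mulr_sumr; congr (_ + _); apply: eq_bigr => i _.
  by rewrite mxE mulrA.
by rewrite ffunE dotL2Zl.
Qed.

Lemma dotZDr u v w : dotZ u (v + w) = dotZ u v + dotZ u w.
Proof. by rewrite dotZC dotZDl !(dotZC u). Qed.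

Lemma dotZZr c u v : dotZ u (c *: v) = c * dotZ u v.
Proof. by rewrite dotZC dotZZl dotZC. Qed.

Lemma dotZNr u v : dotZ u (- v) = - dotZ u v.
Proof. by rewrite -scaleN1r dotZZr mulN1r. Qed.

Lemma dotZ0r m (u : Z a b m) : dotZ u 0 = 0.
Proof.
rewrite dotZE !big1 ?addr0// => i _; last by rewrite mxE mulr0.
by rewrite ffunE dotL2C -(scale0r 0) dotL2Zl mul0r.
Qed.

Lemma dotZ_stack u v u' v' :
  dotZ (stackZ u v) (stackZ u' v') = dotZ u u' + dotZ v v'.
Proof.
rewrite !dotZE /= !big_split_ord /= addrACA.
congr (_ + _ + (_ + _)); apply: eq_bigr => i _; rewrite ?col_mxEu ?col_mxEd//.
  by rewrite !ffunE (unsplitK (inl i)).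
by rewrite !ffunE (unsplitK (inr i)).
Qed.

Lemma topZ_stack u v : topZ (stackZ u v) = u.
Proof.
case: u => u1 u2; rewrite /topZ /= col_mxKu; congr pair.
by apply/ffunP => i; rewrite !ffunE (unsplitK (inl i)).
Qed.

Lemma botZ_stack u v : botZ (stackZ u v) = v.
Proof.
case: v => v1 v2; rewrite /botZ /= col_mxKd; congr pair.
by apply/ffunP => i; rewrite !ffunE (unsplitK (inr i)).
Qed.

Lemma normZZ c u : normZ (c *: u) = `|c| * normZ u.
Proof.
by rewrite /normZ dotZZl dotZZr mulrA -expr2 sqrtrM ?sqr_ge0// sqrtr_sqr.
Qed.

(** * Adjunction, the block form, and multiples of signals *)

Lemma adjointP (A : Z a b n -> Z a b n) :
  is_adjoint A (adjoint A) \/ adjoint A = 0.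
Proof.
rewrite /adjoint; case: xgetP => [B -> AB|_]; first by left.
by right.
Qed.

Lemma adjoint_skew (S : Z a b n -> Z a b n) :
  adjoint S = - S -> is_adjoint S (- S).
Proof.
move=> hS; case: (adjointP S); rewrite hS// => /eqP.
rewrite oppr_eq0 => /eqP -> u v.
by rewrite oppr0 [LHS]dotZC !dotZ0r.
Qed.

Lemma adjoint_self (P : Z a b n -> Z a b n) :
  adjoint P = P -> is_adjoint P P.
Proof.
move=> hP; case: (adjointP P); rewrite hP// => -> u v.
by rewrite [LHS]dotZC !dotZ0r.
Qed.

Lemma dotZ_block_ge0 (P S : Z a b n -> Z a b n) (delta : R) (h : Z a b n) :
  `|delta| <= 1 -> is_adjoint S (- S) -> is_adjoint P P -> nonnegZ P ->
  0 <= dotZ (stackZ h (delta *: h))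
            (blockZ P S (- S) (- P) (stackZ h (delta *: h))).
Proof.
move=> hd hS hP P0.
(* By skewness and symmetry this number equals its own opposite. *)
have S0 u : dotZ u (S u) = 0.
  have := hS u u; rewrite dotZNr dotZC => /eqP.
  by rewrite -subr_eq0 opprK -mulr2n mulrn_eq0 => /eqP.
(* [S] and [P] are bare functions here, so the scalar is extracted by adjunction: it is moved to the
   other side of the inner product, where bilinearity applies. *)
have S1 : dotZ h (S (delta *: h)) = 0.
  rewrite -[RHS]oppr0 -(mulr0 delta) -(S0 h) [in RHS]dotZC -dotZZr hS dotZNr opprK//.
have P1 : dotZ h (P (delta *: h)) = delta * dotZ h (P h).
  by rewrite -hP dotZZr hP.
rewrite /blockZ topZ_stack botZ_stack dotZ_stack !dotZDr S1.
rewrite !dotZZl !dotZNr S0 P1.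
have := P0 h; set p := dotZ _ _ => p0.
have -> : p + 0 + (delta * - 0 + delta * - (delta * p)) = (1 - delta ^+ 2) * p.
  by ring.
by rewrite mulr_ge0// subr_ge0 -real_normK ?num_real// exprn_ile1.
Qed.

(** Meant for [u] the image of [v] under the multiplication operator, so that [H] may be applied to
    the explicit multiple. The simple functions approximating [u] also approximate [c *: v], and
    [|c| <= 1] bounds its norm pointwise by that of [v]. *)
Lemma Le_scale {c : R} {u v : R -> Z a b n} : `|c| <= 1 ->
  Le u -> Le v -> eqL u (fun t => c *: v t) -> Le (fun t => c *: v t).
Proof.
move=> c1 [[s [simps us]] _] [_ intv] ucv; split.
  exists s; split; first exact: simps.
  apply: ae_imp2 us ucv => t ust ucvt t0.
  rewrite -(ucvt t0).
  exact: ust.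
move=> T T0; apply: le_lt_trans (intv T T0).
apply: ge0_le_integral_nonmeas => t _; rewrite lee_fin ?sqr_ge0//.
by rewrite normZZ exprMn ler_piMl ?sqr_ge0// exprn_ile1.
Qed.

Lemma linearL_scale {H : (R -> Z a b n) -> (R -> Z a b n)} (c : R)
    {v : R -> Z a b n} :
  linearL H -> Le v -> eqL (H (fun t => c *: v t)) (fun t => c *: H v t).
Proof.
(* Writing [c *: v] as [(c - 1) *: v + v] fits the form of [linearL] with [v] as the only signal, so
   no fact about the zero signal is called for. *)
move=> linH Lv; have := linH (c - 1) v v Lv Lv.
have -> : (c - 1) *: v + v = (fun t => c *: v t).
  by rewrite scalerBl scale1r subrK.
by have -> : (c - 1) *: H v + H v = (fun t => c *: H v t)
  by rewrite scalerBl scale1r subrK.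
Qed.

End InnerProduct.

Theorem lemma10 (R : realType) (a b : R) (hab : a < b) (n : nat * nat)
    (Delta : (R -> Z a b n) -> (R -> Z a b n)) (hDelta : operatorL Delta)
    (delta : R) (hdelta : `|delta| <= 1)
    (hDelta_mul : forall v, Le v -> eqL (Delta v) (fun t => delta *: v t))
    (P S : Z a b n -> Z a b n) (hP : is_PI P) (hS : is_PI S)
    (hS_skew : adjoint S = - S) (hP_adj : adjoint P = P) (hP_ge0 : nonnegZ P)
    (H : (R -> Z a b n) -> (R -> Z a b n)) (hH : operatorL H)
    (hH_lin : linearL H) (hH_causal : causalL H) (hH_bounded : boundedL H) :
  hard_IQC Delta (blockL H 0 0 H) (blockZ P S (adjoint S) (- P)).
Proof.
move=> T v T0 Lv /=; set w := blockL _ _ _ _ _.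
have Ldv : Le (fun t => delta *: v t).
  exact: Le_scale hdelta (hDelta.1 v Lv) Lv (hDelta_mul v Lv).
(* [Delta v] and [delta *: v] agree only almost everywhere, so exchanging them under [H] relies on
   [H] respecting classes; linearity then extracts [delta]. *)
have HD : eqL (H (Delta v)) (fun t => delta *: H v t).
  apply: ae_imp2 (hH.2 _ _ (hDelta.1 v Lv) Ldv (hDelta_mul v Lv))
    (linearL_scale delta hH_lin Lv) => t e1 e2 t0.
  by rewrite e1// e2.
have wE t : w t = stackZ (H v t) (H (Delta v) t).
  rewrite /w /blockL /stackL.
  under [fun t => topZ _]eq_fun do rewrite topZ_stack.
  under [fun t => botZ _]eq_fun do rewrite botZ_stack.
  by congr stackZ; rewrite ?addr0 ?add0r.
apply: Rintegral_ae_ge0; apply: ae_imp HD => t HDt /=.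
(* Past time [T] both truncated signals are 0 and so is the integrand; up to [T] the pointwise
   inequality for the block operator applies with [h = H v t]. *)
rewrite in_itv/= andbT => t0; rewrite /trunc /multL; case: ifP => _; last first.
  by rewrite dotZ0r.
rewrite wE HDt// hS_skew; apply: dotZ_block_ge0 => //.
  exact: adjoint_skew.
exact: adjoint_self.
Qed.
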